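(* Let $\tilde g:\mathbb{R}^n\to\mathbb{R}$ and let $Z$ be a one-dimensional random variable whose distribution lies in $$\mathcal{P}=\{\mathbb{P} : \mathbb{P}(Z\in[-1,1])=1,\ \mathbb{E}_{\mathbb{P}}[Z]=0,\ \mathbb{E}_{\mathbb{P}}[|Z|]=d\}$$ for some $d\in[0,1]$. For any $\epsilon\in(0,\tfrac12)$ and $\mathbf{x}\in\mathbb{R}^n$ it holds that $$\inf_{\mathbb{P}\in\mathcal{P}}\mathbb{P}\big(\tilde g(\mathbf{x})+Z\le 0\big)\ge 1-\epsilon$$ if and only if $$\tilde g(\mathbf{x})+\min\Big\{1,\ \frac{d}{2\epsilon}\Big\}\le 0.$$
   Context: $\mathcal{P}$ ranges over all Borel probability measures on $\mathbb{R}$ (distributions of $Z$) with the listed properties. *)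

(* Defs.v *)
From HB Require Import structures.
From mathcomp Require Import all_boot all_order all_algebra.
From mathcomp Require Import all_classical all_reals all_analysis.
Set Implicit Arguments.
Unset Strict Implicit.
Unset Printing Implicit Defensive.
Import Order.TTheory GRing.Theory Num.Theory.
Import numFieldNormedType.Exports.
Local Open Scope classical_set_scope.
Local Open Scope ring_scope.

(* A distribution of Z is a Borel probability measure on the real line, under
   which Z is the coordinate (identity) random variable. *)
Definition Zid (R : realType) : measurableTypeR R -> R := idfun.
Arguments Zid {R}.

(* The expectations are extended-real Lebesgue integrals; the support condition
   makes Zid integrable, so 'E_P[Zid] is never a difference of infinities. *)
Definition ambiguity_set (R : realType) (d : R) :
    set (probability (measurableTypeR R) R) :=
  [set P : probability (measurableTypeR R) R |
    [/\ P [set z | -1 <= Zid z <= 1] = 1%E,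
        ('E_P[Zid] = 0)%E
      & ('E_P[fun z => `|Zid z|%R] = d%:E)%E]].

(* Main.v *)
Require Import Defs.
From HB Require Import structures.
From mathcomp Require Import all_boot all_order all_algebra.
From mathcomp Require Import all_classical all_reals all_analysis.
From mathcomp Require Import measurable_realfun ring lra.
Import Order.TTheory GRing.Theory Num.Theory.
Import numFieldNormedType.Exports.
Local Open Scope classical_set_scope.
Local Open Scope ring_scope.

(** Put [t := - g x]. The constraint [g x + Z <= 0] is [Z <= t], so the claim is
    that the upper tail [P (Z > t)] is at most [eps] for all distributions of
    the ambiguity set exactly when [t >= min 1 (d / (2 eps))].

    Sufficiency. If [t >= 1], the event [Z <= t] contains the support. If
    [t >= d / (2 eps)], the two moment conditions fix the mean of the positive
    part of [Z], since [|Z| + Z = 2 Z^+] has expectation [d]; Markov's inequality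
    then gives [2 t P (Z > t) <= d] ([ambiguity_set_upper_tail]), which bounds the
    tail by [eps] as soon as [t > 0]. The remaining case [t = 0] forces [d = 0],
    so that [Z = 0] almost surely ([ambiguity_set0_gt0]).

    Necessity. For [d > 0], the worst case puts the positive part of [Z] at one
    point [s > t] with mass [p = d / (2 s)], so that Markov's inequality loses
    nothing at level [s]; the negative part is put at [-1] with mass [d / 2], and the rest of the mass at [0]. As
    [s < d / (2 eps)], the tail has mass [p > eps]. The total mass allows this
    when [s >= d / (2 - d)], and [eps < 1 / 2] with [d <= 1] leaves room for
    such an [s]. When [d = 0], [t] is negative and the Dirac mass at [0] suffices
    ([exists_tail_atom], [exists_large_upper_tail]). *)

(** The normalization of a measure of total mass 1 is that measure again, and it
    carries a probability structure; the point [t0] provides the default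
    probability that normalization requires. *)
Lemma probability_of_mass1 d (T : measurableType d) (R : realType) (t0 : T)
    (m : {measure set T -> \bar R}) :
  m setT = 1%E ->
  exists P : probability T R, forall A, P A = m A.
Proof.
move=> m1; exists (mnormalize m (dirac t0)) => A.
by rewrite /= /mnormalize m1 onee_eq0 /= invr1 mule1.
Qed.

(** Specifying the law by its values and by its expectations lets the moment
    conditions of the extremal distribution reduce to arithmetic. *)
Lemma three_point_probability d (T : measurableType d) (R : realType)
    (p q r : R) (a b c : T) :
  0 <= p -> 0 <= q -> 0 <= r -> p + q + r = 1 ->
  exists P : probability T R,
    (forall A, P A = (p * \1_A a + q * \1_A b + r * \1_A c)%:E) /\
    (forall f : T -> R, measurable_fun setT f ->
       ('E_P[f] = (p * f a + q * f b + r * f c)%:E)%E).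
Proof.
move=> p0 q0 r0 pqr.
pose atom (k : R) (k0 : 0 <= k) (x : T) : {measure set T -> \bar R} :=
  mscale (NngNum k0) (@dirac _ T x R).
pose mab : {measure set T -> \bar R} := measure_add (atom p p0 a) (atom q q0 b).
pose m : {measure set T -> \bar R} := measure_add mab (atom r r0 c).
have mE A : m A = (p * \1_A a + q * \1_A b + r * \1_A c)%:E.
  rewrite [LHS]measure_addE [X in (X + _)%E]measure_addE.
  by rewrite /atom /= /mscale /= /dirac !EFinD !EFinM.
have [|P Pm] := @probability_of_mass1 _ T R a m.
  by rewrite mE !indicT !mulr1 pqr.
have ge0P (f : T -> R) : measurable_fun setT f -> (forall x, 0 <= f x) ->
    (\int[P]_x (f x)%:E = (p * f a + q * f b + r * f c)%:E)%E.
  move=> mf f0.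
  have /measurable_EFinP mfE := mf.
  have f0' x : setT x -> (0 <= (EFin \o f) x)%E by rewrite /= lee_fin.
  rewrite (eq_measure_integral m); last by move=> A _ _; exact: Pm.
  rewrite ge0_integral_measure_add// ge0_integral_measure_add//.
  rewrite !ge0_integral_mscale// !integral_dirac// !diracT !mul1e.
  by rewrite !EFinD !EFinM.
exists P; split; first by move=> A; rewrite Pm mE.
(* The integrals of measure sums and multiples are computed for nonnegative
   functions; a signed one is split into its positive and negative parts. *)
move=> f mf; rewrite unlock integralE funerpos funerneg.
rewrite ge0P; [|exact: measurable_funrpos|exact: funrpos_ge0].
rewrite ge0P; [|exact: measurable_funrneg|exact: funrneg_ge0].
have fE x : f x = f^\+ x - f^\- x by rewrite -[in LHS](funrposBneg f).
by rewrite -EFinB (fE a) (fE b) (fE c); congr EFin; lra.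
Qed.

Lemma measurable_Zid (R : realType) : measurable_fun setT (@Zid R).
Proof. exact: measurable_id. Qed.

Lemma measurable_norm_Zid (R : realType) :
  measurable_fun setT (fun z => `|@Zid R z|).
Proof. by apply: measurableT_comp => //; exact: measurable_Zid. Qed.

Lemma measurable_Zid_gt (R : realType) (t : R) :
  measurable [set z | t < @Zid R z].
Proof.
have -> : [set z | t < @Zid R z] = `]t, +oo[%classic by rewrite set_itvE.
exact: measurable_itv.
Qed.

Lemma setC_Zid_gt (R : realType) (t : R) :
  [set z | - t + @Zid R z <= 0] = ~` [set z | t < @Zid R z].
Proof.
apply/funext => z; apply/propext => /=.
rewrite (_ : (- t + Zid z <= 0) = ~~ (t < Zid z)); first by split => /negP.
by rewrite -leNgt addrC subr_le0.
Qed.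

(** Markov's inequality at level [2 t] for [|Z| + Z], whose expectation is [d]
    and which exceeds [2 t] wherever [Z > t >= 0]. Using [|Z| + Z] in place of
    [|Z|] gains the factor 2 that makes the bound tight. *)
Lemma ambiguity_set_upper_tail (R : realType) (d t : R)
    (P : probability (measurableTypeR R) R) :
  ambiguity_set d P -> 0 <= t ->
  ((2 * t)%:E * P [set z | (t < Zid z)%R] <= d%:E)%E.
Proof.
move=> [_ EZ EabsZ] t0.
have mZ := @measurable_Zid R; have mabsZ := @measurable_norm_Zid R.
have d0 : 0 <= d by rewrite -lee_fin -EabsZ expectation_ge0.
have iZ : P.-integrable setT (EFin \o @Zid R).
  apply/integrableP; split; first exact/measurable_EFinP.
  by move: EabsZ; rewrite unlock => /= ->; rewrite ltry.
have iabsZ : P.-integrable setT (EFin \o (fun z => `|@Zid R z|)).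
  apply/integrableP; split; first exact/measurable_EFinP.
  move: EabsZ; rewrite unlock => /= E.
  by under eq_integral do rewrite normr_id; rewrite E ltry.
have EabsZZ : ('E_P[((fun z => `|Zid z|) \+ Zid)%R] = d%:E)%E.
  by rewrite expectationD ?EZ ?EabsZ ?adde0//; exact/Lfun1_integrable.
have [->|tneq0] := eqVneq t 0; first by rewrite mulr0 mul0e lee_fin.
have t20 : 0 < 2 * t by rewrite mulr_gt0// lt_neqAle eq_sym tneq0.
have mX : measurable_fun setT ((fun z => `|Zid z|) \+ @Zid R).
  exact: measurable_funD.
pose X : {RV P >-> R} :=
  HB.pack ((fun z => `|Zid z|) \+ @Zid R) (isMeasurableFun.Build _ _ _ _ _ mX).
have XE z : X z = `|Zid z| + Zid z by [].
have X0 z : 0 <= X z by rewrite XE -lerBlDr sub0r -normrN ler_norm.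
have absX : Num.norm \o X = X.
  by apply/funext => z; exact: (ger0_norm (X0 z)).
have := @markov _ _ _ P X id _ t20 (@measurable_id _ _ _) (fun r h => h)
  (fun x y _ _ h => h).
have -> : id \o (fun x : R => `|x|) \o X = X by exact: absX.
rewrite EabsZZ; apply: le_trans.
apply: lee_pmul => //; first by rewrite lee_fin ltW.
apply: le_measure; rewrite ?inE//.
- exact: measurable_Zid_gt.
- rewrite -[X in measurable X]setTI.
  apply: emeasurable_fun_c_infty => //; apply: measurableT_comp => //.
  exact/measurable_EFinP.
- move=> z tz; have {}tz : t < Zid z := tz.
  suff : ((2 * t)%:E <= `|(X z)%:E|)%E by [].
  rewrite lee_fin; apply: le_trans (ler_norm (X z)); rewrite XE.
  have := ler_norm (Zid z); lra.
Qed.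

(** The case [d = 0], [t = 0], where the previous bound is vacuous: [Z] vanishes
    almost surely because its absolute value has zero integral. *)
Lemma ambiguity_set0_gt0 (R : realType) (P : probability (measurableTypeR R) R) :
  ambiguity_set 0 P -> P [set z | 0 < Zid z] = 0%E.
Proof.
move=> [_ _]; rewrite unlock => EabsZ.
have /measurable_EFinP mZ := @measurable_Zid R.
have ae0 := (ae_eq_integral_abs P measurableT mZ).1 EabsZ.
apply: (@negligibleP _ _ _ P _ (measurable_Zid_gt _ _)).1.
apply: negligibleS ae0 => z /= z0 /(_ I) [] zE.
by move: z0; rewrite zE ltxx.
Qed.

(** The position [s] and mass [p] of the atom above [t] in the extremal
    distribution: [p * s = d / 2] balances the mass [d / 2] placed at [-1], and
    [p + d / 2 <= 1] leaves a nonnegative mass for the origin. *)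
Lemma exists_tail_atom (R : realFieldType) (d eps t : R) :
  0 <= d <= 1 -> 0 < eps < 1 / 2 -> t < Num.min 1 (d / (2 * eps)) ->
  exists p s : R,
    [/\ [/\ 0 <= p, p + d / 2 <= 1 & eps < p], [/\ 0 <= s, s <= 1 & t < s]
      & p * s = d / 2].
Proof.
move=> /andP[d0 d1] /andP[eps0 eps12]; set u := Num.min _ _ => tu.
have [d_eq0|d_neq0] := eqVneq d 0.
  (* Then t < 0 and the whole mass can sit at the origin. *)
  exists 1, 0; move: tu; rewrite /u d_eq0 mul0r lt_min => /andP[_ t0].
  by split; [split; lra|split; lra|lra].
have dpos : 0 < d by rewrite lt_neqAle eq_sym d_neq0.
have u1 : u <= 1 by rewrite ge_min lexx.
have ud : u * (2 * eps) <= d.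
  by rewrite -ler_pdivlMr ?mulr_gt0// ge_min lexx orbT.
(* The smallest position for which p + d / 2 <= 1, where p = d / (2 s). *)
pose m := d / (2 - d).
have d2 : 0 < 2 - d by lra.
have mE : m * (2 - d) = d by rewrite divfK// gt_eqF.
have m0 : 0 < m by rewrite divr_gt0.
have m1 : m <= 1 by rewrite ler_pdivrMr//; lra.
have meps : m * (2 * eps) < d by nra.
have [s [ms s1 ts sd]] :
    exists s, [/\ m <= s, s <= 1, t < s & s * (2 * eps) < d].
  have [tm|mt] := ltP t m; first by exists m.
  exists ((t + u) / 2); split; [lra|lra|lra|].
  apply: lt_le_trans ud; rewrite ltr_pM2r ?mulr_gt0//; lra.
have s0 : 0 < s by lra.
have s20 : 0 < 2 * s by lra.
have psE : d / (2 * s) * s = d / 2 by field; rewrite gt_eqF.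
exists (d / (2 * s)), s; split => //; last by split => //; exact: ltW.
split; first by rewrite divr_ge0//; lra.
- suff : d / (2 * s) <= 1 - d / 2 by lra.
  rewrite ler_pdivrMr//; nra.
- rewrite ltr_pdivlMr//; lra.
Qed.

Lemma exists_large_upper_tail (R : realType) (d eps t : R) :
  0 <= d <= 1 -> 0 < eps < 1 / 2 -> t < Num.min 1 (d / (2 * eps)) ->
  exists2 P : probability (measurableTypeR R) R, ambiguity_set d P &
    (eps%:E < P [set z | (t < Zid z)%R])%E.
Proof.
move=> hd heps tu.
have [p [s [[p0 pd peps] [s0 s1 ts] ps]]] := exists_tail_atom _ _ _ _ hd heps tu.
have /andP[d0 d1] := hd.
have [|||P [PE EP]] := @three_point_probability _ (measurableTypeR R) R
  p (d / 2) (1 - p - d / 2) s (- 1) 0 p0; [lra..|].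
exists P.
  split.
  - have in1 (y : R) : -1 <= y -> y <= 1 ->
        \1_[set z | -1 <= @Zid R z <= 1] y = 1 :> R.
      by move=> y0 y1; rewrite indicE mem_set//=; apply/andP.
    have -> : 1%E = (p * 1 + d / 2 * 1 + (1 - p - d / 2) * 1)%:E.
      by congr EFin; lra.
    by rewrite PE !in1//; lra.
  - by rewrite EP; [rewrite /Zid/=; congr EFin; lra | exact: measurable_Zid].
  - rewrite EP; last exact: measurable_norm_Zid.
    by rewrite /Zid/= ger0_norm// normrN1 normr0; congr EFin; lra.
have tailE : \1_[set z | t < @Zid R z] s = 1 :> R by rewrite indicE mem_set.
rewrite PE lte_fin tailE mulr1 (lt_le_trans peps)// -addrA lerDl.
by rewrite addr_ge0// mulr_ge0//; lra.
Qed.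

Theorem theorem10 (R : realType) (n : nat) (g : 'rV[R]_n -> R) (d : R)
    (hd : 0 <= d <= 1) (eps : R) (heps : 0 < eps < 1 / 2) (x : 'rV[R]_n) :
  ((1 - eps)%:E <=
     ereal_inf [set P [set z | (g x + Zid z <= 0)%R] | P in ambiguity_set d])%E
  <-> g x + Num.min 1 (d / (2 * eps)) <= 0.
Proof.
rewrite -(opprK (g x)); move: (- g x) => t.
rewrite setC_Zid_gt [- t + _]addrC subr_le0.
have tail_le_epsP (P : probability (measurableTypeR R) R) :
    ((1 - eps)%:E <= P (~` [set z | (t < Zid z)%R]) <->
     P [set z | (t < Zid z)%R] <= eps%:E)%E.
  rewrite probability_setC; last exact: measurable_Zid_gt.
  have /fineK <- : P [set z | t < Zid z] \is a fin_num.
    by rewrite fin_num_measure//; exact: measurable_Zid_gt.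
  rewrite -EFinB !lee_fin; split; lra.
have [eps0 eps12] := andP heps; have [d0 d1] := andP hd.
split => [/ereal_infP inf_ge|].
  rewrite leNgt; apply/negP => /(exists_large_upper_tail _ _ _ _ hd heps)[P dP].
  rewrite ltNge => /negP; apply; apply/tail_le_epsP; apply: inf_ge.
  by exists P.
move=> mt; apply/ereal_infP => _ [P dP <-]; apply/tail_le_epsP.
move: mt; rewrite ge_min => /orP[t1|dt].
  apply/tail_le_epsP; have [PS _ _] := dP.
  apply: (@le_trans _ _ 1%E); first by rewrite lee_fin; lra.
  rewrite -PS; apply: le_measure; rewrite ?inE.
  - have -> : [set z | -1 <= @Zid R z <= 1] = `[-1, 1]%classic.
      by rewrite set_itvE.
    exact: measurable_itv.
  - by apply: measurableC; exact: measurable_Zid_gt.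
  - move=> z /= /andP[_ z1]; apply/negP; rewrite -leNgt; exact: le_trans z1 _.
have t0 : 0 <= t by apply: le_trans dt; rewrite divr_ge0//; lra.
have [t_eq0|tneq0] := eqVneq t 0.
  have d_eq0 : d = 0.
    by move: dt; rewrite t_eq0 ler_pdivrMr; lra.
  by move: dP; rewrite t_eq0 d_eq0 => /ambiguity_set0_gt0 ->; rewrite lee_fin ltW.
have t20 : 0 < 2 * t by rewrite mulr_gt0// lt_neqAle eq_sym tneq0.
rewrite -(@lee_pmul2l _ (2 * t)%:E)//.
apply: le_trans (ambiguity_set_upper_tail _ _ _ _ dP t0) _.
rewrite -EFinM lee_fin; move: dt; rewrite ler_pdivrMr; lra.
Qed.
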